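(* Let $(X,d_X)$ and $(Y,d_Y)$ be metric spaces and let $\mathcal{M}:Y\rightrightarrows X$ be a set-valued mapping such that $\operatorname{gph}\mathcal{M}$ is closed in $Y\times X$. Let $\overline{y}\in\operatorname{dom}\mathcal{M}$ and assume that $\mathcal{M}$ is locally compact around $\overline{y}$. Then $$\operatorname{Lipusc}\mathcal{M}(\overline{y})=\sup_{x\in\mathcal{M}(\overline{y})}\operatorname{clm}\mathcal{M}(\overline{y},x).$$
   Context: For a set-valued mapping $\mathcal{M}:Y\rightrightarrows X$ between metric spaces, $\operatorname{dom}\mathcal{M}=\{y\in Y: \mathcal{M}(y)\neq\emptyset\}$ and $\operatorname{gph}\mathcal{M}=\{(y,x)\in Y\times X: x\in\mathcal{M}(y)\}$. The point-to-set distance is $d_X(x,\Omega)=\inf_{z\in\Omega}d_X(x,z)$, with $d_X(x,\emptyset)=+\infty$. Lipschitz upper semicontinuity modulus: for $\overline{y}\in\operatorname{dom}\mathcal{M}$, $\operatorname{Lipusc}\mathcal{M}(\overline{y})\in[0,+\infty]$ is the infimum of all $\kappa\ge 0$ for which there is a neighborhood $V$ of $\overline{y}$ with $d_X(x,\mathcal{M}(\overline{y}))\le\kappa\, d_Y(y,\overline{y})$ for all $y\in V$ and all $x\in\mathcal{M}(y)$ (with $\inf\emptyset=+\infty$). Calmness modulus: for $(\overline{y},\overline{x})\in\operatorname{gph}\mathcal{M}$, $\operatorname{clm}\mathcal{M}(\overline{y},\overline{x})\in[0,+\infty]$ is the infimum of all $\kappa\ge 0$ for which there are neighborhoods $V$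 of $\overline{y}$ and $U$ of $\overline{x}$ with $d_X(x,\mathcal{M}(\overline{y}))\le\kappa\, d_Y(y,\overline{y})$ for all $y\in V$ and all $x\in\mathcal{M}(y)\cap U$ (with $\inf\emptyset=+\infty$). Locally compact around $\overline{y}$: there is a neighborhood $V$ of $\overline{y}$ whose image $\mathcal{M}(V)=\bigcup_{y\in V}\mathcal{M}(y)$ is relatively compact in $X$ (contained in a compact subset of $X$). *)

(* Defs.v *)
From mathcomp Require Import all_boot all_order all_algebra.
From mathcomp Require Import all_classical all_reals all_analysis.

Set Implicit Arguments.
Unset Strict Implicit.
Unset Printing Implicit Defensive.

Import Order.TTheory GRing.Theory Num.Theory.

Local Open Scope classical_set_scope.
Local Open Scope ring_scope.

(* A set-valued mapping M : Y => X is a function Y -> set X. *)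

Definition svdom (X Y : Type) (M : Y -> set X) : set Y :=
  [set y | M y !=set0].

Definition svgph (X Y : Type) (M : Y -> set X) : set (Y * X) :=
  [set yx | M yx.1 yx.2].

(* Extended-real valued, so that the distance to the empty set is +oo. *)
Definition dist_to_set (R : realType) (X : metricType R) (x : X) (A : set X) :
  \bar R := ereal_inf [set (mdist x z)%:E | z in A].

(* An infimum in \bar R over real constants k; it is +oo if there is no
   admissible k. *)
Definition Lipusc (R : realType) (X Y : metricType R) (M : Y -> set X)
    (ybar : Y) : \bar R :=
  ereal_inf [set k%:E | k in [set k : R | 0 <= k /\
    exists V : set Y, nbhs ybar V /\
      forall y x, V y -> M y x ->
        (dist_to_set x (M ybar) <= (k * mdist y ybar)%:E)%E]].

(* Meaningful for (ybar, xbar) in svgph M. *)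
Definition clm (R : realType) (X Y : metricType R) (M : Y -> set X)
    (ybar : Y) (xbar : X) : \bar R :=
  ereal_inf [set k%:E | k in [set k : R | 0 <= k /\
    exists (V : set Y) (U : set X), [/\ nbhs ybar V, nbhs xbar U &
      forall y x, V y -> (M y `&` U) x ->
        (dist_to_set x (M ybar) <= (k * mdist y ybar)%:E)%E]]].

(* Relatively compact means contained in a compact subset; no closedness of K
   is required, since it is automatic in a metric space. *)
Definition locally_compact_around (R : realType) (X Y : metricType R)
    (M : Y -> set X) (ybar : Y) : Prop :=
  exists (V : set Y) (K : set X),
    [/\ nbhs ybar V, compact K & \bigcup_(y in V) M y `<=` K].

(* Main.v *)
(** Let [s] be the supremum and [k > s].  Each [x] in [M ybar] satisfies the
    [k]-estimate locally since [clm M ybar x < k]; each [x] outside [M ybar]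
    satisfies it vacuously near [(ybar, x)] since the graph is closed.  A compact
    set containing the values of [M] near [ybar] makes the neighborhood of [ybar]
    uniform in [x], whence [Lipusc M ybar <= k]. *)

Require Import Defs.
From mathcomp Require Import all_boot all_order all_algebra.
From mathcomp Require Import all_classical all_reals all_analysis.

Import Order.TTheory GRing.Theory Num.Theory.

Local Open Scope classical_set_scope.

Lemma clm_ge0 (R : realType) (X Y : metricType R) (M : Y -> set X)
    (ybar : Y) (xbar : X) : (0 <= clm M ybar xbar)%E.
Proof. by apply: le_ereal_inf_tmp => _ [k [k0 _] <-]; rewrite lee_fin. Qed.

Lemma clm_le_Lipusc (R : realType) (X Y : metricType R) (M : Y -> set X)
    (ybar : Y) (xbar : X) : (clm M ybar xbar <= Lipusc M ybar)%E.
Proof.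
apply: le_ereal_inf_tmp => _ [k [k0 [V [nV HV]]] <-].
apply: ereal_inf_lbound; exists k => //; split => //.
exists V, setT; split => //; first exact: filterT.
by move=> y x Vy [Myx _]; exact: HV.
Qed.

(** Strictness yields an admissible constant [k'] below [k], and [mdist] is nonnegative. The point
    [x] comes before [y] to fit the near-covering form of compactness. *)
Lemma clm_lt_near (R : realType) (X Y : metricType R) (M : Y -> set X)
    (ybar : Y) (xbar : X) (k : R) : (clm M ybar xbar < k%:E)%E ->
  \forall x \near xbar & y \near ybar,
    M y x -> (dist_to_set x (M ybar) <= (k * mdist y ybar)%:E)%E.
Proof.
move=> /ereal_inf_lt[_ [k' [_ [V [U [nV nU H]]]] <-]]; rewrite lte_fin => k'k.
exists (U, V) => // -[x y] [/= Ux Vy] Myx.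
apply: le_trans (H _ _ Vy (conj Myx Ux)) _.
by rewrite lee_fin ler_wpM2r ?mdist_ge0// ltW.
Qed.

Lemma closed_svgph_near (X Y : topologicalType) (M : Y -> set X)
    (ybar : Y) (xbar : X) : closed (svgph M) -> ~ M ybar xbar ->
  \forall x \near xbar & y \near ybar, ~ M y x.
Proof.
move=> clM nM.
have : nbhs (ybar, xbar) (~` svgph M).
  by apply: open_nbhs_nbhs; split => //; exact: closed_openC.
move=> -[[V U] [/= nV nU] H].
by exists (U, V) => // -[x y] [/= Ux Vy]; exact: (H (y, x)).
Qed.

Theorem corollary1 (R : realType) (X Y : metricType R) (M : Y -> set X)
    (ybar : Y) :
  closed (svgph M) ->
  svdom M ybar ->
  locally_compact_around M ybar ->
  Lipusc M ybar = ereal_sup [set clm M ybar x | x in M ybar].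
Proof.
move=> clM [x0 Mx0] [V [K [nV cK VK]]].
apply/eqP; rewrite eq_le; apply/andP; split; last first.
  by apply: ge_ereal_sup => _ [x _ <-]; exact: clm_le_Lipusc.
set s := ereal_sup _.
have clm_s x : M ybar x -> (clm M ybar x <= s)%E.
  by move=> Mx; apply: ereal_sup_ubound; exists x.
(* A point of [M ybar] is needed here: the supremum of the empty set is [-oo]. *)
have s0 : (0 <= s)%E := le_trans (clm_ge0 _ _ _ _ _ _) (clm_s _ Mx0).
case: s s0 clm_s => [s| |] s0 clm_s; rewrite ?leey//.
rewrite lee_fin in s0.
(* The slack [e] makes [clm M ybar x < s + e] strict, even where the supremum is attained. *)
apply/lee_addgt0Pr => e e0; rewrite -EFinD.
apply: ereal_inf_lbound; exists (s + e)%R => //; split.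
  by rewrite addr_ge0// ltW.
have near_K : \forall y \near ybar, K `<=` [set x | M y x ->
    (dist_to_set x (M ybar) <= ((s + e) * mdist y ybar)%:E)%E].
  (* Near-covering turns estimates near each [(x, ybar)] with [x] in [K] into one neighborhood of
     [ybar] serving all of [K]. *)
  move/compact_near_coveringP: cK; apply => x _.
  have [Mx|nMx] := pselect (M ybar x).
    apply: clm_lt_near; apply: le_lt_trans (clm_s _ Mx) _.
    by rewrite lte_fin ltrDl.
  by apply: filterS (closed_svgph_near _ _ _ _ _ clM nMx) => -[x' y] nMyx /nMyx.
(* Intersecting with [V] forces [M y] into [K], where the uniform estimate applies. *)
exists (V `&` [set y | K `<=` [set x | M y x ->
    (dist_to_set x (M ybar) <= ((s + e) * mdist y ybar)%:E)%E]]).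
split; first exact: filterI.
by move=> y x [Vy Ky] Myx; apply: Ky => //; apply: VK; exists y.
Qed.
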